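(* Let $(x_e,u_e)$ be a controlled equilibrium and let $V:\mathcal H\to\mathbb R$ be a storage function. The optimal control problem (OCP) with stage cost $\ell$ is strictly pre-dissipative (respectively, strictly dissipative) at $(x_e,u_e)$ with storage function $V$ if and only if the optimal control problem (OCP$_0$) with stage cost $\tilde\ell$ is strictly pre-dissipative (respectively, strictly dissipative) at $(0,0)$ with storage function $\tilde V=V(\,\cdot\,+x_e)$.
   Context: Setting: $\mathcal H,\mathcal U,\mathcal Y,\mathcal Z$ are Hilbert spaces (real or complex, over the same field), $A$ generates a $C_0$-semigroup on $\mathcal H$, and $B\in L(\mathcal U,\mathcal H)$, $C\in L(\mathcal H,\mathcal Y)$, $K\in L(\mathcal U,\mathcal Z)$ are bounded linear operators, $z\in\mathcal H$, $v\in\mathcal U$. It is assumed that there is $c_K>0$ with $\|Ku\|\ge c_K\|Bu\|$ for all $u\in\mathcal U$. The optimal control problem (OCP) is $$\min_{u\in L^2(0,T;\mathcal U)}\int_0^T\ell(x,u)\,dt\quad\text{s.t. }\dot x=Ax+Bu,\ x(0)=x_0,$$ with $\ell(x,u)=\|Cx\|^2+\|Ku\|^2+2\operatorname{Re}\langle z,x\rangle+2\operatorname{Re}\langle v,u\rangle$. A controlled equilibrium is a pair $(x_e,u_e)\in\operatorname{dom}A\times\mathcal U$ with $Ax_e+Bu_e=0$. Given such a pair, (OCP$_0$) is the problem $$\min_{u\in L^2(0,T;\mathcal U)}\int_0^T\tilde\ell(x,u)\,dt\quad\text{s.t. }\dot x=Ax+Bu,\ x(0)=x_0-x_e,$$ with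 $\tilde\ell(x,u)=\|Cx\|^2+\|Ku\|^2+2\operatorname{Re}\langle z+C^*Cx_e,x\rangle+2\operatorname{Re}\langle v+K^*Ku_e,u\rangle$. $\mathcal K$ is the set of continuous strictly increasing functions $\alpha:[0,\infty)\to[0,\infty)$ with $\alpha(0)=0$. A storage function is a (Fréchet, real-linear derivative) $C^1$-function $V:\mathcal H\to\mathbb R$. A problem with dynamics $\dot x=Ax+Bu$ and stage cost $L:\mathcal H\times\mathcal U\to\mathbb R$ is strictly pre-dissipative at a controlled equilibrium $(\bar x,\bar u)$ with storage function $V$ if there is a dissipation rate $\alpha\in\mathcal K$ such that for all $x\in\operatorname{dom}A$ and $u\in\mathcal U$: $V'(x)(Ax+Bu)\le L(x,u)-L(\bar x,\bar u)-\alpha(\|x-\bar x\|)$. It is strictly dissipative at $(\bar x,\bar u)$ with storage function $V$ if in addition $V$ is bounded from below. *)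

(* Defs.v *)
From HB Require Import structures.
From mathcomp Require Import all_boot all_order all_algebra.
From mathcomp Require Import sesquilinear complex.
From mathcomp Require Import all_classical all_reals all_analysis.

Set Implicit Arguments.
Unset Strict Implicit.
Unset Printing Implicit Defensive.

Import Order.TTheory GRing.Theory Num.Theory.
Import numFieldNormedType.Exports.

Local Open Scope classical_set_scope.
Local Open Scope ring_scope.

Variant scalar_kind := RealScalars | ComplexScalars.

Definition scalar (R : realType) (k : scalar_kind) : numFieldType :=
  match k with RealScalars => R | ComplexScalars => R[i] end.

Definition scalar_re {R : realType} {k : scalar_kind} : scalar R k -> R :=
  match k with RealScalars => idfun | ComplexScalars => @complex.Re R end.

Definition scalar_conj {R : realType} {k : scalar_kind} :
    scalar R k -> scalar R k :=
  match k with RealScalars => idfun | ComplexScalars => @conjc R end.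

Definition scalar_of_real {R : realType} {k : scalar_kind} : R -> scalar R k :=
  match k with RealScalars => idfun | ComplexScalars => real_complex R end.

(* Linear in the first argument, conjugate-linear in the second.  Since the
   norm of a [completeNormedModType K] is [K]-valued, the compatibility between
   norm and inner product is an equation between (real) scalars of [K]. *)
Record hilbert (R : realType) (k : scalar_kind) := Hilbert {
  hilbert_sort :> completeNormedModType (scalar R k);
  inner : {dot hilbert_sort for @scalar_conj R k};
  innerxx : forall x : hilbert_sort, inner x x = `|x| ^+ 2
}.

Definition hnorm {R : realType} {k : scalar_kind} {H : hilbert R k} (x : H) : R :=
  scalar_re `|x|.

Definition re_inner {R : realType} {k : scalar_kind} {H : hilbert R k}
  (x y : H) : R := scalar_re (inner H x y).

(* For continuous [C] these values exist and are unique, by Riesz representation. *)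
Definition adjoint {R : realType} {k : scalar_kind} {H Y : hilbert R k}
    (C : {linear H -> Y}) (y : Y) : H :=
  get [set h : H | forall x : H, inner Y (C x) y = inner H x h].

Section ScalarOfReal.
Context {R : realType} {k : scalar_kind}.
Implicit Types a b : R.

Fact scalar_of_realM a b :
  scalar_of_real (a * b) = scalar_of_real a * scalar_of_real b :> scalar R k.
Proof. by case: (k) => //=; rewrite rmorphM. Qed.

Fact scalar_of_realD a b :
  scalar_of_real (a + b) = scalar_of_real a + scalar_of_real b :> scalar R k.
Proof. by case: (k) => //=; rewrite rmorphD. Qed.

Fact scalar_of_real0 : scalar_of_real 0 = 0 :> scalar R k.
Proof. by case: (k). Qed.

Fact scalar_of_real1 : scalar_of_real 1 = 1 :> scalar R k.
Proof. by case: (k). Qed.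

Fact scalar_of_real_norm a :
  scalar_of_real `|a| = `|scalar_of_real a : scalar R k|.
Proof. by case: (k) => //=; rewrite normc_def /= expr0n addr0 sqrtr_sqr. Qed.

Fact scalar_of_real_le a b :
  (scalar_of_real a <= scalar_of_real b :> scalar R k) = (a <= b).
Proof. by rewrite /scalar_of_real; case: (k) => //=; rewrite lecR. Qed.

Fact scalar_of_hnorm (H : hilbert R k) (x : H) :
  scalar_of_real (hnorm x) = `|x|.
Proof.
rewrite /hnorm; move: (normr_ge0 x); move: `|x|.
by rewrite /scalar_of_real /scalar_re; case: (k) => //= -[a b] /=;
  rewrite lecE /= => /andP[/eqP-> _].
Qed.

Fact scalar_of_real_inj a b :
  scalar_of_real a = scalar_of_real b :> scalar R k -> a = b.
Proof.
by move=> ab; apply/eqP; rewrite eq_le -!scalar_of_real_le ab lexx.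
Qed.

End ScalarOfReal.

(* The real normed space underlying a Hilbert space: the library's differential
   on it is the Frechet differential with real-linear derivatives. *)
Definition realification {R : realType} {k : scalar_kind} (H : hilbert R k) :
  Type := H.

Section Realification.
Context {R : realType} {k : scalar_kind} (H : hilbert R k).

HB.instance Definition _ := GRing.Zmodule.copy (realification H) H.

Let rscale (a : R) (x : realification H) : realification H :=
  (scalar_of_real a : scalar R k) *: (x : H).

Fact rscaleA a b x : rscale a (rscale b x) = rscale (a * b) x.
Proof. by rewrite /rscale scalerA scalar_of_realM. Qed.

Fact rscale1 : left_id 1 rscale.
Proof. by move=> x; rewrite /rscale scalar_of_real1 scale1r. Qed.

Fact rscaleDr : right_distributive rscale +%R.
Proof. by move=> a x y; rewrite /rscale scalerDr. Qed.

Fact rscaleDl x : {morph rscale^~ x : a b / a + b}.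
Proof. by move=> a b; rewrite /rscale scalar_of_realD scalerDl. Qed.

HB.instance Definition _ := GRing.Zmodule_isLmodule.Build R (realification H)
  rscaleA rscale1 rscaleDr rscaleDl.

Let rnorm (x : realification H) : R := hnorm (x : H).

Fact ler_rnormD x y : rnorm (x + y) <= rnorm x + rnorm y.
Proof.
rewrite -(scalar_of_real_le (k := k)) scalar_of_realD !scalar_of_hnorm.
exact: ler_normD.
Qed.

Fact rnormZ (a : R) (x : realification H) : rnorm (a *: x) = `|a| * rnorm x.
Proof.
apply: (@scalar_of_real_inj _ k).
by rewrite scalar_of_realM !scalar_of_hnorm scalar_of_real_norm -normrZ.
Qed.

Fact rnorm0_eq0 x : rnorm x = 0 -> x = 0.
Proof.
move=> x0; apply/eqP; rewrite -[_ == _]normr_eq0 -scalar_of_hnorm.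
by rewrite -/(rnorm x) x0 scalar_of_real0.
Qed.

HB.instance Definition _ := @Lmodule_isNormed.Build R (realification H)
  rnorm ler_rnormD rnormZ rnorm0_eq0.

End Realification.

(* Continuity of the derivative is with respect to the operator norm. *)
Definition C1 {R : realType} {k : scalar_kind} (H : hilbert R k) (V : H -> R) :=
  let V' (x : realification H) := 'd (V : realification H -> R) x in
  (forall x : realification H, differentiable (V : realification H -> R) x) /\
  (forall (x : realification H) (e : R), 0 < e ->
    \forall y \near x, forall h : realification H,
      `|V' y h - V' x h| <= e * `|h|).

Definition C0_semigroup {R : realType} {k : scalar_kind} {H : hilbert R k}
    (S : R -> {linear H -> H}) :=
  [/\ forall t, 0 <= t -> continuous (S t),
      S 0 =1 id,
      forall s t, 0 <= s -> 0 <= t -> S (s + t) =1 S s \o S t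
    & forall x, S t x @[t --> 0^'+] --> x].

(* An unbounded operator is a domain together with a total function, whose
   values off the domain are irrelevant. *)
Definition generates_C0_semigroup {R : realType} {k : scalar_kind}
    {H : hilbert R k} (domA : set H) (A : H -> H) :=
  exists S : R -> {linear H -> H}, C0_semigroup S /\
    let quotient x (t : R) : H := scalar_of_real t^-1 *: (S t x - x) in
    domA = [set x | cvg (quotient x t @[t --> 0^'+])] /\
    forall x, domA x -> quotient x t @[t --> 0^'+] --> A x.

Definition stage_cost {R : realType} {k : scalar_kind} {H U Y Z : hilbert R k}
    (C : {linear H -> Y}) (K : {linear U -> Z}) (z : H) (v : U)
    (x : H) (u : U) : R :=
  hnorm (C x) ^+ 2 + hnorm (K u) ^+ 2 + 2 * re_inner z x + 2 * re_inner v u.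

Definition controlled_equilibrium {R : realType} {k : scalar_kind}
    {H U : hilbert R k} (domA : set H) (A : H -> H) (B : {linear U -> H})
    (x : H) (u : U) := domA x /\ A x + B u = 0.

(* Only the values on the half-line matter. *)
Definition class_K {R : realType} (alpha : R -> R) :=
  [/\ {within `[0, +oo[, continuous alpha},
      forall r, 0 <= r -> 0 <= alpha r,
      forall r s, 0 <= r -> r < s -> alpha r < alpha s
    & alpha 0 = 0].

Definition strictly_pre_dissipative {R : realType} {k : scalar_kind}
    {H U : hilbert R k} (domA : set H) (A : H -> H) (B : {linear U -> H})
    (L : H -> U -> R) (xbar : H) (ubar : U) (V : H -> R) :=
  [/\ controlled_equilibrium domA A B xbar ubar,
      C1 V
    & exists2 alpha : R -> R, class_K alpha &
        forall (x : H) (u : U), domA x ->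
          'd (V : realification H -> R) (x : realification H) (A x + B u)
          <= L x u - L xbar ubar - alpha (hnorm (x - xbar))].

Definition strictly_dissipative {R : realType} {k : scalar_kind}
    {H U : hilbert R k} (domA : set H) (A : H -> H) (B : {linear U -> H})
    (L : H -> U -> R) (xbar : H) (ubar : U) (V : H -> R) :=
  strictly_pre_dissipative domA A B L xbar ubar V /\ has_lbound (range V).

(* Main.v *)
Require Import Defs.
From mathcomp Require Import all_boot all_order all_algebra.
From mathcomp Require Import sesquilinear complex.
From mathcomp Require Import all_classical all_reals all_analysis.
From mathcomp Require Import ring lra.
Import Order.TTheory GRing.Theory Num.Theory.
Import numFieldNormedType.Exports.
Import Defs.
Local Open Scope classical_set_scope.
Local Open Scope ring_scope.

(** The substitution [(x, u) = (y + xe, u' + ue)] carries one dissipation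
    inequality onto the other, term by term and with the same rate [alpha]:

    - the vector field [A x + B u] is unchanged because [A xe + B ue = 0]
      ([generator_linear] makes this meaningful: [dom A] is a linear subspace on
      which [A] is linear, so translation by [xe] is a bijection of [dom A]);
    - the derivative of [V (_ + xe)] at [y] is that of [V] at [y + xe]
      ([diff_translate], [C1_translate]);
    - the supply rate [ell x u - ell xe ue] equals the shifted cost at
      [(y, u')], which vanishes at [(0, 0)] ([stage_cost_translate],
      [stage_cost0]).  Expanding [|C (y + xe)|^2], the cross term
      [2 Re <C y, C xe>] is linear in [y], and the adjoint turns it into the
      linear term [2 Re <C^* C xe, y>]; likewise for [K].

    A lower bound is preserved because [V] and its translate have the same range.

    The cross terms need the adjoint of a bounded operator to exist, hence the
    Riesz representation theorem ([riesz_representation_re]).  It is obtained for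
    real parts by minimising [|x|^2 - 2 f x]: a minimising sequence is Cauchy by
    the parallelogram law, and the first variation at its limit [h] says that
    [f w = Re <w, h>].  Working with real parts treats real and complex scalars
    uniformly; the scalar identity follows by multiplying [w] by scalars
    ([eq_scalar_re]). *)

(** * Real parts of scalars *)

Section Scalars.
Context {R : realType} {k : scalar_kind}.
Implicit Types (a : R) (p q : scalar R k).

Lemma scalar_reD p q : scalar_re (p + q) = scalar_re p + scalar_re q.
Proof. by move: p q; rewrite /scalar_re; case: (k) => //= -[? ?] [? ?]. Qed.

Lemma scalar_reZ a p : scalar_re (scalar_of_real a * p) = a * scalar_re p.
Proof.
by move: p; rewrite /scalar_re /scalar_of_real; case: (k) => //= -[? ?] /=;
  rewrite mul0r subr0.
Qed.

Lemma scalar_reJ p : scalar_re (scalar_conj p) = scalar_re p.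
Proof. by move: p; rewrite /scalar_re /scalar_conj; case: (k) => //= -[? ?]. Qed.

Lemma scalar_of_realK a : scalar_re (scalar_of_real a : scalar R k) = a.
Proof. by case: (k). Qed.

Lemma scalar_reK p : 0 <= p -> scalar_of_real (scalar_re p) = p.
Proof.
by move: p; rewrite /scalar_of_real /scalar_re; case: (k) => //= -[a b] /=;
  rewrite lecE /= => /andP[/eqP-> _].
Qed.

Lemma scalar_of_real_lt a b :
  (scalar_of_real a < scalar_of_real b :> scalar R k) = (a < b).
Proof. by rewrite /scalar_of_real; case: (k) => //=; rewrite ltcR. Qed.

Lemma scalar_of_realX2 a :
  scalar_of_real (a ^+ 2) = scalar_of_real a ^+ 2 :> scalar R k.
Proof. by rewrite !expr2 scalar_of_realM. Qed.

(** In the complex case, [c = 1] compares the real parts and [c = 'i] the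
    imaginary ones. *)
Lemma eq_scalar_re p q :
  (forall c : scalar R k, scalar_re (c * p) = scalar_re (c * q)) -> p = q.
Proof.
move: p q; rewrite /scalar_re; case: (k) => /= [p q /(_ 1)|[a b] [c d] h].
  by rewrite !mul1r.
have := h 'i%C; have := h 1; rewrite /= !(mul1r, mul0r, subr0, sub0r).
by move=> -> /oppr_inj ->.
Qed.

End Scalars.

(** * The real part of the inner product *)

Section RealInnerProduct.
Context {R : realType} {k : scalar_kind} {H : hilbert R k}.
Implicit Types (a : R) (x y w : H).

Lemma re_innerDl x y w : re_inner (x + y) w = re_inner x w + re_inner y w.
Proof. by rewrite /re_inner linearDl scalar_reD. Qed.

Lemma re_innerZl a x y :
  re_inner ((scalar_of_real a : scalar R k) *: x) y = a * re_inner x y.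
Proof. by rewrite /re_inner linearZl_LR scalar_reZ. Qed.

Lemma re_innerC x y : re_inner x y = re_inner y x.
Proof.
by rewrite /re_inner [LHS](congr1 _ (hermitian_subproof x y)) expr0 mul1r
  scalar_reJ.
Qed.

Lemma re_innerDr x y w : re_inner w (x + y) = re_inner w x + re_inner w y.
Proof. by rewrite !(re_innerC w) re_innerDl. Qed.

Lemma re_innerZr a x y :
  re_inner x ((scalar_of_real a : scalar R k) *: y) = a * re_inner x y.
Proof. by rewrite !(re_innerC x) re_innerZl. Qed.

Lemma re_innerNl x y : re_inner (- x) y = - re_inner x y.
Proof.
by apply/eqP; rewrite -addr_eq0 -re_innerDl addNr /re_inner linear0l; case: (k).
Qed.

Lemma re_innerNr x y : re_inner x (- y) = - re_inner x y.
Proof. by rewrite !(re_innerC x) re_innerNl. Qed.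

Lemma re_innerxx x : re_inner x x = hnorm x ^+ 2.
Proof.
by rewrite /re_inner innerxx -scalar_of_hnorm -scalar_of_realX2 scalar_of_realK.
Qed.

Lemma hnorm_ge0 x : 0 <= hnorm x.
Proof. by rewrite -(@scalar_of_real_le _ k) scalar_of_real0 scalar_of_hnorm. Qed.

Lemma hnormD_sqr x y :
  hnorm (x + y) ^+ 2 = hnorm x ^+ 2 + 2 * re_inner x y + hnorm y ^+ 2.
Proof.
rewrite -!re_innerxx !(re_innerDl, re_innerDr) (re_innerC y x); ring.
Qed.

Lemma hnormB_sqr x y :
  hnorm (x - y) ^+ 2 = hnorm x ^+ 2 - 2 * re_inner x y + hnorm y ^+ 2.
Proof.
rewrite -!re_innerxx !(re_innerDl, re_innerDr) !(re_innerNl, re_innerNr).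
rewrite (re_innerC y x); ring.
Qed.

Lemma hnormZ a x : hnorm ((scalar_of_real a : scalar R k) *: x) = `|a| * hnorm x.
Proof.
apply: (@scalar_of_real_inj _ k).
by rewrite scalar_of_realM !scalar_of_hnorm scalar_of_real_norm -normrZ.
Qed.

Lemma hnorm_eq0 x : hnorm x = 0 -> x = 0.
Proof.
by move=> x0; apply/eqP; rewrite -normr_eq0 -scalar_of_hnorm x0 scalar_of_real0.
Qed.

(** Expanding [hnorm (b x - a y) ^+ 2 >= 0] for [a = hnorm x], [b = hnorm y]. *)
Lemma re_inner_le x y : re_inner x y <= hnorm x * hnorm y.
Proof.
have := hnorm_ge0 x; rewrite le_eqVlt => /predU1P[/esym x0|x_gt0].
  by rewrite x0 (hnorm_eq0 _ x0) /re_inner linear0l mul0r; case: (k).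
have := hnorm_ge0 y; rewrite le_eqVlt => /predU1P[/esym y0|y_gt0].
  by rewrite y0 (hnorm_eq0 _ y0) /re_inner linear0r mulr0; case: (k).
have := sqr_ge0 (hnorm ((scalar_of_real (hnorm y) : scalar R k) *: x
                        - (scalar_of_real (hnorm x) : scalar R k) *: y)).
rewrite hnormB_sqr re_innerZl re_innerZr !hnormZ.
rewrite !ger0_norm ?hnorm_ge0// => h.
have ab_gt0 := mulr_gt0 x_gt0 y_gt0.
rewrite -(ler_pM2l ab_gt0); lra.
Qed.

End RealInnerProduct.

(** * Riesz representation and adjoints *)

Section Riesz.
Context {R : realType} {k : scalar_kind} {H : hilbert R k}.

Let rz (a : R) (x : H) : H := (scalar_of_real a : scalar R k) *: x.

(** The representing vector is the minimiser of [J x = |x|^2 - 2 f x], found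
    without projecting onto the kernel of [f]. *)
Lemma riesz_representation_re (f : H -> R) (M : R) :
  (forall x y, f (x + y) = f x + f y) ->
  (forall a x, f ((scalar_of_real a : scalar R k) *: x) = a * f x) ->
  (forall x, f x <= M * hnorm x) ->
  exists h : H, forall x, f x = re_inner x h.
Proof.
move=> fD fZ fM.
pose J x := hnorm x ^+ 2 - 2 * f x.
(* Completing the square in [hnorm x]. *)
have J_ge x : - M ^+ 2 <= J x.
  have := fM x; have := sqr_ge0 (hnorm x - M); rewrite /J; nra.
have J_lb : has_lbound (range J) by exists (- M ^+ 2) => _ [x _ <-].
pose m := inf (range J).
have m_le x : m <= J x by apply: ge_inf => //; exists x.
have has_infJ : has_inf (range J) by split => //; exists (J 0), 0.
have [x_ x_min] : exists x_ : nat -> H, forall n, J (x_ n) < m + n.+1%:R^-1.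
  suff /choice[x_ hx] : forall n, exists x, J x < m + n.+1%:R^-1 by exists x_.
  move=> n.
  have n1_gt0 : 0 < n.+1%:R^-1 :> R by rewrite invr_gt0.
  have [_ [x _ <-] xm] := inf_adherent n1_gt0 has_infJ.
  by exists x.
(* Parallelogram law: [J x + J y = 2 J ((x + y) / 2) + |x - y|^2 / 2], and the
   value of [J] at the midpoint is at least [m]. *)
have J_mid x y : hnorm (x - y) ^+ 2 <= 2 * (J x - m + (J y - m)).
  have := m_le (rz 2^-1 (x + y)).
  rewrite /J /rz fZ fD hnormZ exprMn hnormD_sqr hnormB_sqr.
  rewrite ger0_norm ?invr_ge0 ?ler0n//; lra.
have inv_small (e : R) : 0 < e -> exists N, forall n, (N <= n)%N -> n.+1%:R^-1 < e :> R.
  move=> e0; have [N _ hN] := near_infty_natSinv_lt (PosNum e0).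
  by exists N => n Nn; apply: hN.
have x_cvg : cvg (x_ @ \oo).
  apply: cauchy_cvg; apply: cauchy_exP => eps eps_gt0.
  pose e := scalar_re eps.
  have epsE : eps = scalar_of_real e by rewrite /e scalar_reK// ltW.
  have e_gt0 : 0 < e by rewrite -(@scalar_of_real_lt _ k) -epsE scalar_of_real0.
  have e4_gt0 : 0 < e ^+ 2 / 4 by rewrite divr_gt0// exprn_gt0.
  have [N hN] := inv_small _ e4_gt0.
  exists (x_ N); exists N => // n /= Nn.
  rewrite -ball_normE /ball_ /= epsE -scalar_of_hnorm scalar_of_real_lt.
  rewrite -(@ltr_pXn2r _ 2)// ?nnegrE ?hnorm_ge0 ?ltW//.
  apply: le_lt_trans (J_mid _ _) _.
  have := x_min N; have := x_min n; have := hN _ Nn; have := hN _ (leqnn N).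
  move: (_^-1) (n.+1%:R^-1) => a b; lra.
pose h : H := lim (x_ @ \oo).
have x_near e : 0 < e -> exists n, hnorm (h - x_ n) < e /\ n.+1%:R^-1 < e.
  move=> e_gt0; have [N1 hN1] := inv_small e e_gt0.
  have e_gt0' : 0 < scalar_of_real e :> scalar R k.
    by rewrite -(@scalar_of_real0 _ k) scalar_of_real_lt.
  have [N2 _ hN2] := (cvgrPdist_lt _ _).1 x_cvg _ e_gt0'.
  exists (maxn N1 N2); split; last by apply: hN1; rewrite leq_maxl.
  rewrite -(@scalar_of_real_lt _ k) scalar_of_hnorm.
  by apply: hN2; rewrite /= leq_maxr.
(* [J (h + w) - J h >= 0], obtained as the limit of
   [J (x_ n + w) - J (x_ n) >= - n.+1^-1]; this needs no continuity of [J]. *)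
have first_variation w : 0 <= 2 * (re_inner w h - f w) + hnorm w ^+ 2.
  pose c := 2 * hnorm w + 1.
  have c_gt0 : 0 < c by have := hnorm_ge0 w; rewrite /c; lra.
  rewrite -oppr_le0; apply/ler_addgt0Pl => e e_gt0; rewrite addr0.
  have [n [xn_h xn_min]] := x_near _ (divr_gt0 e_gt0 c_gt0).
  have := m_le (x_ n + w); have := x_min n.
  have := re_inner_le w (x_ n - h).
  rewrite re_innerDr re_innerNr /J hnormD_sqr fD (re_innerC _ w).
  have -> : hnorm (x_ n - h) = hnorm (h - x_ n).
    by rewrite /hnorm distrC.
  have : e = c * (e / c) by rewrite mulrC divfK// gt_eqF.
  have := ler_wpM2l (hnorm_ge0 w) (ltW xn_h).
  move: xn_min; rewrite /c; move: (e / _) (_^-1) => d i; lra.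
exists h => w; apply/eqP; rewrite eq_sym -subr_eq0; apply/eqP.
set g := _ - _.
have quadratic t : 0 <= 2 * (t * g) + t ^+ 2 * hnorm w ^+ 2.
  have := first_variation (rz t w).
  by rewrite /rz re_innerZl fZ hnormZ exprMn real_normK ?num_real// -mulrBr.
(* The minimiser [- g / |w|^2] of the quadratic, with [+ 1] to allow [w = 0]. *)
have := quadratic (- g / (hnorm w ^+ 2 + 1)).
set n := hnorm w ^+ 2; have n_ge0 : 0 <= n by exact: sqr_ge0.
have n1_gt0 : 0 < n + 1 by lra.
have -> : 2 * (- g / (n + 1) * g) + (- g / (n + 1)) ^+ 2 * n =
          - (g ^+ 2 * (n + 2)) / (n + 1) ^+ 2 by field; lra.
rewrite pmulr_lge0 ?invr_gt0 ?exprn_gt0// => g_le0.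
by apply/eqP; rewrite -sqrf_eq0 eq_le sqr_ge0 andbT; nra.
Qed.

End Riesz.

Lemma linear_continuous_hnorm_le {R : realType} {k : scalar_kind}
    {H Y : hilbert R k} (C : {linear H -> Y}) :
  continuous C -> exists2 M : R, 0 <= M & forall x, hnorm (C x) <= M * hnorm x.
Proof.
move=> /linear_bounded_continuous/linear_boundedP[M [M_real CM]].
have r_ge0 : 0 <= `|M| + 1 by rewrite addr_ge0.
have M_lt_r : M < `|M| + 1.
  by rewrite (le_lt_trans (real_ler_norm M_real))// ltrDl.
exists (scalar_re (`|M| + 1)) => [|x].
  by rewrite -(@scalar_of_real_le _ k) scalar_of_real0 scalar_reK.
rewrite -(@scalar_of_real_le _ k) scalar_of_realM !scalar_of_hnorm scalar_reK//.
exact: CM.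
Qed.

(** [adjoint] is a choice operator; this is the existence that it presupposes. *)
Lemma adjointP {R : realType} {k : scalar_kind} {H Y : hilbert R k}
    (C : {linear H -> Y}) (y : Y) (x : H) :
  continuous C -> inner Y (C x) y = inner H x (adjoint C y).
Proof.
move=> /linear_continuous_hnorm_le[M M_ge0 CM].
suff exh : exists h : H, forall x, inner Y (C x) y = inner H x h.
  exact: (getPex exh).
have [||w|h hE] := @riesz_representation_re _ _ _
    (fun w => re_inner (C w) y) (M * hnorm y).
- by move=> u w; rewrite linearD re_innerDl.
- by move=> a w; rewrite linearZ re_innerZl.
- by apply: le_trans (re_inner_le _ _) _; rewrite mulrAC ler_wpM2r ?hnorm_ge0.
exists h => w; apply: eq_scalar_re => c; have := hE (c *: w).
by rewrite /re_inner linearZ !linearZl_LR.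
Qed.

Lemma re_inner_adjoint {R : realType} {k : scalar_kind} {H Y : hilbert R k}
    (C : {linear H -> Y}) (y : Y) (x : H) :
  continuous C -> re_inner (adjoint C y) x = re_inner (C x) y.
Proof. by move=> hC; rewrite re_innerC /re_inner -adjointP. Qed.

(** * Generators, derivatives and stage costs under translation *)

(** The difference quotients of a semigroup are linear in the vector, so both
    their convergence and their limits are inherited by linear combinations. *)
Lemma generator_linear {R : realType} {k : scalar_kind} {H : hilbert R k}
    (domA : set H) (A : H -> H) (a : scalar R k) (x y : H) :
  generates_C0_semigroup domA A -> domA x -> domA y ->
  domA (a *: x + y) /\ A (a *: x + y) = a *: A x + A y.
Proof.
move=> [S [_ [domE A_lim]]] dx dy.
have lim_lin : (scalar_of_real t^-1 : scalar R k) *: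
      (S t (a *: x + y) - (a *: x + y)) @[t --> 0^'+] --> a *: A x + A y.
  rewrite [X in X @ _ --> _](_ : _ = fun t : R =>
      a *: ((scalar_of_real t^-1 : scalar R k) *: (S t x - x))
      + (scalar_of_real t^-1 : scalar R k) *: (S t y - y)).
    by apply: cvgD; [apply: cvgZr; exact: A_lim | exact: A_lim].
  apply/funext => t; rewrite linearP scalerA [a * _]mulrC -scalerA -scalerDr.
  by congr (_ *: _); rewrite scalerBr opprD addrACA.
have dxy : domA (a *: x + y) by rewrite domE; apply: cvgP lim_lin.
by split=> //; apply: cvg_unique (A_lim _ dxy) lim_lin.
Qed.

Lemma is_diff_translate {R : numFieldType} {E F : normedModType R} (f : E -> F)
    (c x : E) :
  differentiable f (x + c) ->
  is_diff x (fun y => f (y + c)) ('d f (x + c)).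
Proof.
move=> /differentiableP f_diff.
apply: (is_diff_eq (is_diff_comp (_ : is_diff x (+%R^~ c) id) f_diff)) => //.
by apply: (is_diff_eq (is_diffD _ _)); apply/funext => h /=; rewrite addr0.
Qed.

Lemma near_translate {R : numFieldType} {E : normedModType R} (P : set E)
    (c x : E) :
  (\forall y \near x + c, P y) -> \forall y \near x, P (y + c).
Proof.
have cvg_shift : y + c @[y --> x] --> x + c.
  by apply: cvgD; [exact: cvg_id | exact: cvg_cst].
by move=> /cvg_shift.
Qed.

Lemma diff_translate {R : realType} {k : scalar_kind} {H : hilbert R k}
    (V : H -> R) (c : H) (x h : realification H) :
  C1 V ->
  'd ((fun y : H => V (y + c)) : realification H -> R) x h =
  'd (V : realification H -> R) (x + c : realification H) h.
Proof.
move=> [V_diff _].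
have d_eq := @diff_val _ _ _ _ _ _ _
  (is_diff_translate _ _ _ (V_diff (x + c : realification H))).
by rewrite -d_eq.
Qed.

Lemma C1_translate {R : realType} {k : scalar_kind} {H : hilbert R k}
    (V : H -> R) (c : H) :
  C1 V -> C1 (fun y : H => V (y + c)).
Proof.
move=> V_C1; have [V_diff V'_cont] := V_C1; split => [x|x e e_gt0].
  exact: (@ex_diff _ _ _ _ _ _ _ (is_diff_translate _ _ _ (V_diff (x + c)))).
apply: filterS (near_translate _ _ _ (V'_cont (x + c : realification H) e e_gt0)).
by move=> y V'y h; rewrite !diff_translate; first exact: V'y.
Qed.

(** The adjoints absorb the cross terms of the expanded squares; the quadratic
    terms at [(xe, ue)] and the linear terms there cancel with the subtracted
    cost. *)
Lemma stage_cost_translate {R : realType} {k : scalar_kind}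
    {H U Y Z : hilbert R k} (C : {linear H -> Y}) (K : {linear U -> Z})
    (z : H) (v : U) (xe x : H) (ue u : U) :
  continuous C -> continuous K ->
  stage_cost C K z v (x + xe) (u + ue) - stage_cost C K z v xe ue =
  stage_cost C K (z + adjoint C (C xe)) (v + adjoint K (K ue)) x u.
Proof.
move=> hC hK; rewrite /stage_cost (linearD C) (linearD K) !hnormD_sqr.
rewrite !(re_innerDl, re_innerDr) !re_inner_adjoint//; ring.
Qed.

Lemma stage_cost0 {R : realType} {k : scalar_kind}
    {H U Y Z : hilbert R k} (C : {linear H -> Y}) (K : {linear U -> Z})
    (z : H) (v : U) : stage_cost C K z v 0 0 = 0.
Proof.
have z0 (E : hilbert R k) (w : E) : re_inner w 0 = 0.
  by rewrite /re_inner linear0r; case: (k).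
rewrite /stage_cost !linear0 !z0 -!re_innerxx !z0; ring.
Qed.

Theorem lemma2 (R : realType) (k : scalar_kind) (H U Y Z : hilbert R k)
  (domA : set H) (A : H -> H)
  (B : {linear U -> H}) (C : {linear H -> Y}) (K : {linear U -> Z})
  (z : H) (v : U) (xe : H) (ue : U) (V : H -> R)
  (hA : generates_C0_semigroup domA A)
  (hB : continuous B) (hC : continuous C) (hK : continuous K)
  (hKB : exists2 cK : R, 0 < cK & forall u : U, cK * hnorm (B u) <= hnorm (K u))
  (he : controlled_equilibrium domA A B xe ue)
  (hV : C1 V) :
  let ell := stage_cost C K z v in
  let ell0 := stage_cost C K (z + adjoint C (C xe)) (v + adjoint K (K ue)) in
  let V0 := fun x : H => V (x + xe) in
  (strictly_pre_dissipative domA A B ell xe ue V <->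
     strictly_pre_dissipative domA A B ell0 0 0 V0) /\
  (strictly_dissipative domA A B ell xe ue V <->
     strictly_dissipative domA A B ell0 0 0 V0).
Proof.
move=> ell ell0 V0; have [dxe Axe] := he.
have A_add x : domA x -> domA (x + xe) /\ A (x + xe) = A x + A xe.
  by move=> dx; have := generator_linear _ _ 1 _ _ hA dx dxe; rewrite !scale1r.
have dom_sub x : domA x -> domA (x - xe).
  by move=> dx; have [] := generator_linear _ _ (- 1) _ _ hA dxe dx;
    rewrite scaleN1r addrC.
have he0 : controlled_equilibrium domA A B 0 0.
  have [] := generator_linear _ _ (- 1) _ _ hA dxe dxe.
  by rewrite !scaleN1r !addNr => d0 A0; split; rewrite // A0 linear0 addr0.
have rate_iff (alpha : R -> R) :
    (forall x u, domA x ->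
      'd (V : realification H -> R) (x : realification H) (A x + B u)
      <= ell x u - ell xe ue - alpha (hnorm (x - xe))) <->
    (forall x u, domA x ->
      'd (V0 : realification H -> R) (x : realification H) (A x + B u)
      <= ell0 x u - ell0 0 0 - alpha (hnorm (x - 0))).
  (* [A (x + xe) + B (u + ue) = A x + B u] by equilibrium. *)
  have pointE x u : domA x ->
      ('d (V0 : realification H -> R) (x : realification H) (A x + B u)
         <= ell0 x u - ell0 0 0 - alpha (hnorm (x - 0))) =
      ('d (V : realification H -> R) (x + xe : realification H)
          (A (x + xe) + B (u + ue))
         <= ell (x + xe) (u + ue) - ell xe ue
            - alpha (hnorm (x + xe - xe))).
    move=> dx; rewrite /V0 diff_translate// (A_add _ dx).2 linearD.
    rewrite addrACA Axe addr0 addrK subr0.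
    by rewrite /ell stage_cost_translate// /ell0 stage_cost0 subr0.
  split=> h x u dx.
    by rewrite pointE//; apply: h; exact: (A_add _ dx).1.
  have := h _ (u - ue) (dom_sub _ dx).
  by rewrite (pointE _ _ (dom_sub _ dx)) !subrK.
have pre_iff : strictly_pre_dissipative domA A B ell xe ue V <->
    strictly_pre_dissipative domA A B ell0 0 0 V0.
  split=> -[_ _ [alpha alphaK h]].
    split; [exact: he0 | exact: C1_translate |].
    by exists alpha; [exact: alphaK | exact: (rate_iff alpha).1].
  split; [exact: he | exact: hV |].
  by exists alpha; [exact: alphaK | exact: (rate_iff alpha).2].
have range_V0 : range V0 = range V.
  apply/seteqP; split=> _ [x _ <-]; first by exists (x + xe).
  by exists (x - xe); rewrite // /V0 subrK.
split; first exact: pre_iff.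
rewrite /strictly_dissipative range_V0.
by split=> -[V_pre V_lb]; split; [exact: pre_iff.1 | | exact: pre_iff.2 |].
Qed.
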